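(* Let $\mathcal{X}$ and $\mathcal{Y}$ be Riemannian manifolds, let $\widehat{\mathcal{Y}} \subseteq \mathcal{Y}$ be a Riemannian submanifold of $\mathcal{Y}$, let $\mathcal{Z}$ be a smooth manifold, and let $\hat{c}, c \in \mathcal{Z}$. Let $R: \mathcal{X} \times \widehat{\mathcal{Y}} \to \mathcal{Z}$ and $S: \mathcal{X} \times \mathcal{Y} \to \mathcal{Z}$ be such that $R(x,y) = \hat{c}$ and $S(x,y) = c$ are feasible constant-rank equations (FCREs), and assume that the former is more constrained than the latter, i.e. $R^{-1}(\hat{c}) \subseteq S^{-1}(c)$. If $R(x_0,y_0) = \hat{c}$ for some $(x_0,y_0)$, then $$\kappa_{\star}[S^{-1}(c)](x_0,y_0) \le \kappa_{\star}[R^{-1}(\hat{c})](x_0,y_0).$$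
   Context: Smooth means infinitely differentiable. Let $\mathcal{X},\mathcal{Y},\mathcal{Z}$ be smooth manifolds, $c\in\mathcal{Z}$ a constant, and $F:\mathcal{X}\times\mathcal{Y}\to\mathcal{Z}$ a smooth map. The equation $F(x,y)=c$ is called a feasible constant-rank equation (FCRE) if (1) for all $x\in\mathcal{X}$ there exists $y\in\mathcal{Y}$ such that $F(x,y)=c$; and (2) there exists $r\in\mathbb{N}$ such that $\operatorname{rank}\frac{\partial}{\partial y}F(x,y)=r$ and $\operatorname{rank} DF(x,y)=r$ for all $(x,y)\in\mathcal{X}\times\mathcal{Y}$. Latent condition number. Suppose $F(x,y)=c$ is an FCRE, $\mathcal{X}$ and $\mathcal{Y}$ are Riemannian manifolds, and $F(x_0,y_0)=c$. For $x$ in a sufficiently small neighbourhood of $x_0$, the canonical solution map $H_{y_0}(x):=\arg\min\{d_{\mathcal{Y}}(y_0,y) : y\in\mathcal{Y},\ F(x,y)=c\}$ is well defined and smooth, where $d_{\mathcal{Y}}$ is the geodesic distance. The latent condition number of $F$ at $(x_0,y_0)$ is $$\kappa_\star[F^{-1}(c)](x_0,y_0):=\kappa[H_{y_0}](x_0)=\left\|\left(\frac{\partial}{\partial y}F(x_0,y_0)\right)^\dagger\frac{\partial}{\partial x}F(x_0,y_0)\right\|,$$ where $\kappa[H](x_0):=\limsup_{x\to x_0}\frac{d_{\mathcal{Y}}(H(x_0),H(x))}{d_{\mathcal{X}}(x,x_0)}$ with geodesic distances, $\|\cdot\|$ is the operator norm, and $\cdot^\dagger$ is the Moore--Penrose inverse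 with respect to the Riemannian inner product on $T_{y_0}\mathcal{Y}$ and any inner product on $T_c\mathcal{Z}$ (the product above sends $\xi$ to the unique $\eta\in(\ker\frac{\partial}{\partial y}F(x_0,y_0))^\perp$ with $\frac{\partial}{\partial y}F(x_0,y_0)[\eta]=\frac{\partial}{\partial x}F(x_0,y_0)[\xi]$, independently of the inner product on $T_c\mathcal{Z}$). A Riemannian submanifold $\widehat{\mathcal{Y}}\subseteq\mathcal{Y}$ carries the metric induced from $\mathcal{Y}$, and $\kappa_\star[R^{-1}(\hat c)]$ is defined using $\widehat{\mathcal{Y}}$ with this metric. A problem $\mathcal{P}\subseteq\mathcal{X}\times\mathcal{Y}$ is more constrained than $\mathcal{P}'$ if $\mathcal{P}\subseteq\mathcal{P}'$; the problem defined by $F(x,y)=c$ is $F^{-1}(c)$. *)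

(* Defs.v *)
From mathcomp Require Import all_boot all_order all_algebra.
From mathcomp Require Import all_classical all_reals all_analysis.
Set Implicit Arguments.
Unset Strict Implicit.
Unset Printing Implicit Defensive.
Import Order.TTheory GRing.Theory Num.Theory.
Import numFieldNormedType.Exports.
Local Open Scope classical_set_scope.
Local Open Scope ring_scope.

(* [U] is meant to be open and [V] finite-dimensional; [f] may be arbitrary
   outside [U]. *)
Fixpoint ck_on (K : realType) (V W : normedModType K) (k : nat)
    (U : set V) (f : V -> W) : Prop :=
  match k with
  | 0%N => forall x, U x -> {for x, continuous f}
  | k'.+1 => (forall x, U x -> differentiable f x) /\
             (forall v : V, ck_on k' U ('D_v f))
  end.

Definition smooth_on (K : realType) (V W : normedModType K)
    (U : set V) (f : V -> W) : Prop :=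
  forall k, ck_on k U f.

(* [chart_map] and [chart_inv] are total functions, meaningful only on
   [chart_dom] and on its image respectively. *)
Record chart (K : realType) (M : topologicalType) (n : nat) := Chart {
  chart_dom : set M;
  chart_map :> M -> 'rV[K]_n;
  chart_inv : 'rV[K]_n -> M;
  chart_dom_open : open chart_dom;
  chart_cod_open : open (chart_map @` chart_dom);
  chart_mapK : forall p, chart_dom p -> chart_inv (chart_map p) = p;
  chart_map_continuous :
    forall p, chart_dom p -> {for p, continuous chart_map};
  chart_inv_continuous :
    forall u, (chart_map @` chart_dom) u -> {for u, continuous chart_inv}
}.

Definition chart_cod (K : realType) (M : topologicalType) (n : nat)
    (e : chart K M n) : set 'rV[K]_n :=
  e @` chart_dom e.

(* The atlas need not be maximal: every notion below is independent of the
   choice of an atlas of a given smooth structure. *)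
Record smooth_manifold (K : realType) := SmoothManifold {
  mcarrier :> topologicalType;
  mdim : nat;
  atlas : set (chart K mcarrier mdim);
  chart_at : mcarrier -> chart K mcarrier mdim;
  chart_at_atlas : forall p, atlas (chart_at p);
  chart_at_dom : forall p, chart_dom (chart_at p) p;
  atlas_compatible : forall e e', atlas e -> atlas e' ->
    smooth_on [set u | chart_cod e u /\ chart_dom e' (chart_inv e u)]
              (e' \o chart_inv e);
  manifold_hausdorff : hausdorff_space mcarrier;
  manifold_second_countable : @second_countable mcarrier
}.

Definition smooth_map (K : realType) (M N : smooth_manifold K)
    (f : M -> N) : Prop :=
  continuous f /\
  forall (e : chart K M (mdim M)) (e' : chart K N (mdim N)),
    atlas e -> atlas e' ->
    smooth_on [set u | chart_cod e u /\ chart_dom e' (f (chart_inv e u))]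
              (e' \o f \o chart_inv e).

(* Coordinate expression of a map on a product manifold, in the product of the
   charts [e] and [e'], which identifies K^m x K^n with K^(m + n). *)
Definition prod_coord (K : realType) (X Y Z : smooth_manifold K)
    (F : X * Y -> Z) (e : chart K X (mdim X)) (e' : chart K Y (mdim Y))
    (e'' : chart K Z (mdim Z)) (w : 'rV[K]_(mdim X + mdim Y)) :
    'rV[K]_(mdim Z) :=
  e'' (F (chart_inv e (lsubmx w), chart_inv e' (rsubmx w))).

Definition smooth_map2 (K : realType) (X Y Z : smooth_manifold K)
    (F : X * Y -> Z) : Prop :=
  continuous F /\
  forall (e : chart K X (mdim X)) (e' : chart K Y (mdim Y))
         (e'' : chart K Z (mdim Z)),
    atlas e -> atlas e' -> atlas e'' ->
    smooth_on
      [set w : 'rV[K]_(mdim X + mdim Y) |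
        [/\ chart_cod e (lsubmx w), chart_cod e' (rsubmx w) &
            chart_dom e'' (F (chart_inv e (lsubmx w),
                              chart_inv e' (rsubmx w)))]]
      (prod_coord F e e' e'').

(* The first rank is that of the partial derivative of F in its second
   argument, the second one that of DF. *)
Definition constant_rank (K : realType) (X Y Z : smooth_manifold K)
    (F : X * Y -> Z) (r : nat) : Prop :=
  forall (x : X) (y : Y) (e : chart K X (mdim X)) (e' : chart K Y (mdim Y))
         (e'' : chart K Z (mdim Z)),
    atlas e -> atlas e' -> atlas e'' ->
    chart_dom e x -> chart_dom e' y -> chart_dom e'' (F (x, y)) ->
    \rank ('J (fun v => e'' (F (x, chart_inv e' v))) (e' y)) = r /\
    \rank ('J (prod_coord F e e' e'') (row_mx (e x) (e' y))) = r.

Definition FCRE (K : realType) (X Y Z : smooth_manifold K)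
    (F : X * Y -> Z) (c : Z) : Prop :=
  [/\ smooth_map2 F,
      forall x, exists y, F (x, y) = c &
      exists r, constant_rank F r].

(* With row vectors, ['J f u] acts on the right ('d f u v = v *m 'J f u), so
   that the Gram matrix [G] pulls back to [J *m G *m J^T]. *)
Definition gram_pullback (K : realType) (m n : nat) (J : 'M[K]_(m, n))
    (G : 'M[K]_n) : 'M[K]_m :=
  J *m G *m J^T.

Definition quad_form (K : realType) (n : nat) (G : 'M[K]_n)
    (v : 'rV[K]_n) : K :=
  (v *m G *m v^T) 0 0.

(* [gram e p] is the matrix of the inner product of T_pM in the basis of
   coordinate vectors of [e]; [gram_compatible] says that these matrices
   represent one and the same tensor in all charts. *)
Record riemannian_manifold (K : realType) := RiemannianManifold {
  rmanifold :> smooth_manifold K;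
  gram : chart K rmanifold (mdim rmanifold) -> rmanifold ->
         'M[K]_(mdim rmanifold);
  gram_sym : forall e p, atlas e -> chart_dom e p -> (gram e p)^T = gram e p;
  gram_pos : forall e p, atlas e -> chart_dom e p ->
    forall v, v != 0 -> 0 < quad_form (gram e p) v;
  gram_smooth : forall e, atlas e ->
    smooth_on (chart_cod e) (fun u => gram e (chart_inv e u));
  gram_compatible : forall e e' p, atlas e -> atlas e' ->
    chart_dom e p -> chart_dom e' p ->
    gram e p = gram_pullback ('J (e' \o chart_inv e) (e p)) (gram e' p)
}.

(* The submanifold is given by its inclusion map.  That [i] is an immersion
   follows from [N] carrying the induced metric, which is positive definite;
   [i] is not required to be a topological embedding. *)
Definition riemannian_submanifold (K : realType) (N M : riemannian_manifold K)
    (i : N -> M) : Prop :=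
  [/\ smooth_map i,
      injective i &
      forall (e : chart K N (mdim N)) (e' : chart K M (mdim M)) (p : N),
        atlas e -> atlas e' -> chart_dom e p -> chart_dom e' (i p) ->
        gram e p =
          gram_pullback ('J (e' \o i \o chart_inv e) (e p)) (gram e' (i p))].

(* A C^1 curve on [0, 1] is one that extends to a C^1 curve on an open
   neighbourhood of [0, 1]. *)
Definition C1_curve (K : realType) (M : smooth_manifold K)
    (g : K -> M) : Prop :=
  exists U : set K,
    [/\ open U, `[0, 1] `<=` U,
        forall t, U t -> {for t, continuous g} &
        forall (e : chart K M (mdim M)) t,
          atlas e -> U t -> chart_dom e (g t) ->
          derivable (e \o g) t 1 /\ {for t, continuous (derive1 (e \o g))}].

Definition speed (K : realType) (M : riemannian_manifold K)
    (g : K -> M) (t : K) : K :=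
  let e := chart_at (g t) in
  Num.sqrt (quad_form (gram e (g t)) (derive1 (e \o g) t)).

Definition curve_length (K : realType) (M : riemannian_manifold K)
    (g : K -> M) : \bar K :=
  (\int[lebesgue_measure]_(t in `[0%R, 1%R]) (speed g t)%:E)%E.

(* [piecewise_C1_length p q l]: some piecewise C^1 curve, i.e. some finite
   concatenation of C^1 curves, joins [p] to [q] and has length [l]. *)
Inductive piecewise_C1_length (K : realType) (M : riemannian_manifold K) :
    M -> M -> \bar K -> Prop :=
| C1_piece (g : K -> M) :
    C1_curve g -> piecewise_C1_length (g 0) (g 1) (curve_length g)
| C1_concat (p q r : M) (l l' : \bar K) :
    piecewise_C1_length p q l -> piecewise_C1_length q r l' ->
    piecewise_C1_length p r (l + l')%E.

(* Infinite between points of different connected components. *)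
Definition geodesic_dist (K : realType) (M : riemannian_manifold K)
    (p q : M) : \bar K :=
  ereal_inf [set l | piecewise_C1_length p q l].

Definition closest_solutions (K : realType) (X Y : riemannian_manifold K)
    (Z : smooth_manifold K) (F : X * Y -> Z) (c : Z) (y0 : Y) (x : X) :
    set Y :=
  [set y | F (x, y) = c /\
     forall y', F (x, y') = c ->
       (geodesic_dist y0 y <= geodesic_dist y0 y')%E].

(* H_{y0}(x), a partial map: [None] when the argmin is empty.  The argmin is a
   singleton for [x] close to [x0] whenever F(x, y) = c is an FCRE with
   F(x0, y0) = c, so that neither this case nor the choice made by [xget] among
   several minimizers affects the condition number at [x0]. *)
Definition canonical_solution (K : realType) (X Y : riemannian_manifold K)
    (Z : smooth_manifold K) (F : X * Y -> Z) (c : Z) (y0 : Y) (x : X) :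
    option Y :=
  xget None [set Some y | y in closest_solutions F c y0 x].

Definition option_dist (K : realType) (M : riemannian_manifold K)
    (p q : option M) : \bar K :=
  match p, q with
  | Some p', Some q' => geodesic_dist p' q'
  | _, _ => +oo%E
  end.

(* The limsup is over x -> x0 with x != x0.  The maximum with 0 only matters
   when [x0] is isolated (dim X = 0): [limf_esup] is then -oo, instead of the
   expected 0. *)
Definition condition_number (K : realType) (X Y : riemannian_manifold K)
    (H : X -> option Y) (x0 : X) : \bar K :=
  maxe 0%E
    (limf_esup (fun x => option_dist (H x0) (H x) / geodesic_dist x x0)%E
               x0^').

Definition latent_condition_number (K : realType)
    (X Y : riemannian_manifold K) (Z : smooth_manifold K)
    (F : X * Y -> Z) (c : Z) (x0 : X) (y0 : Y) : \bar K :=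
  condition_number (canonical_solution F c y0) x0.

(* Main.v *)
Require Import Defs.
From mathcomp Require Import all_boot all_order all_algebra.
From mathcomp Require Import all_classical all_reals all_analysis.
From mathcomp Require Import ring.
Set Implicit Arguments.
Unset Strict Implicit.
Unset Printing Implicit Defensive.
Import Order.TTheory GRing.Theory Num.Theory.
Import numFieldNormedType.Exports.
Local Open Scope classical_set_scope.
Local Open Scope ring_scope.

(** The proof works with the canonical solution maps themselves rather than with
    the linear-algebra formula for the condition number.

    Write [d] for the geodesic distances and let [yh] be the closest solution of
    [R (x, _) = chat] to [y0].  A curve in the submanifold is a curve of the
    same length in [Y] ([geodesic_dist_push]), and [incl yh] solves
    [S (x, _) = c], so that the closest solution [y] of the latter satisfies
    [d (incl y0) y <= d (incl y0) (incl yh) <= d y0 yh].  After division by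
    [d x x0], the upper limits compare in the same way.

    What has to be justified is that the closest points exist when they are
    needed and that both solution maps send [x0] to the base point.
    - If the upper limit for [R] is infinite there is nothing to prove.
      Otherwise [d y0 yh <= m * d x x0] near [x0] for some [m], and in
      particular [yh] exists and tends to [y0] ([near_geodesic_dist]).  The
      equation for [S] therefore has a solution close to [incl y0], namely
      [incl yh].
    - The solutions of [S (x, _) = c] form a closed set.  A closed set that
      comes close enough to a point has a point closest to it
      ([closest_point_exists]), because small geodesic balls lie in compact
      coordinate balls, on which the distance to the centre is continuous
      ([geodesic_ball_subset_compact]).
    - At [x0] the base point is the only minimizer, as the geodesic distance
      separates points ([geodesic_dist_gt0]).

    The two facts about the geodesic distance rest on comparing it with the
    norm of a chart.  By compactness the speed of a curve is, in a small closed
    coordinate ball, bounded above and below by multiples of the norm of its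
    coordinate velocity ([coordinate_ball]).  The upper bound, applied to
    straight segments, makes the distance Lipschitz in coordinates
    ([geodesic_dist_segment]).  For the lower bound, curves may leave the
    chart; instead of stopping them at the boundary one integrates along the
    whole curve the derivative of a C^1 bump function supported in the ball,
    a multiple of which is 1-Lipschitz for the geodesic distance
    ([chart_bump_lipschitz]). *)

(** * Directional derivatives of maps between row vectors *)

Section RowVectorCalculus.
Context {K : realType}.

Lemma norm_coord_le n (v : 'rV[K]_n) i : `|v 0 i| <= `|v|.
Proof.
by rewrite [leRHS]/Num.Def.normr/= mx_normrE; exact: (le_bigmax _ _ (0, i)).
Qed.

Lemma derivable_comp_rV n m (f : 'rV[K]_n -> 'rV[K]_m) (u : K -> 'rV[K]_n) t :
  derivable u t 1 -> differentiable f (u t) -> derivable (f \o u) t 1.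
Proof.
move=> /derivable1_diffP du df.
by apply/derivable1_diffP; exact: differentiable_comp.
Qed.

Lemma derive1_comp_rV n m (f : 'rV[K]_n -> 'rV[K]_m) (u : K -> 'rV[K]_n) t :
  derivable u t 1 -> differentiable f (u t) ->
  derive1 (f \o u) t = derive1 u t *m 'J f (u t).
Proof.
move=> /derivable1_diffP du df.
rewrite derive1E'; last exact: differentiable_comp.
by rewrite (diff_comp du df) /= -(derive1E' du) -deriveE// deriveEjacobian.
Qed.

(** The entries of the Jacobian are directional derivatives along the
    coordinate vectors, so that [ck_on 1] makes them continuous. *)
Lemma mulmx_jacobianE n m (f : 'rV[K]_n -> 'rV[K]_m) (a v : 'rV[K]_n) :
  differentiable f a ->
  v *m 'J f a = \sum_i v 0 i *: 'D_(delta_mx 0 i) f a.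
Proof.
move=> df; rewrite -deriveEjacobian// deriveE// {1}(row_sum_delta v) linear_sum.
by apply: eq_bigr => i _; rewrite linearZ -deriveE.
Qed.

End RowVectorCalculus.

(** * Push-forward of C^1 curves *)

Section Curves.
Context {K : realType}.
Implicit Types N M : smooth_manifold K.

Lemma near_chart_dom n (M : topologicalType) (e : chart K M n) (g : K -> M) t :
  {for t, continuous g} -> chart_dom e (g t) ->
  \forall s \near t, chart_dom e (g s).
Proof.
move=> cg ge; apply: cg; apply: open_nbhs_nbhs; split => //.
exact: chart_dom_open.
Qed.

(** The identity is treated as a smooth map, and below as an isometric
    immersion, so that a change of charts is a special case of a
    push-forward. *)
Lemma smooth_map_id M : smooth_map (@idfun M).
Proof.
split; first by move=> p; exact: cvg_id.
by move=> e e' ae ae'; exact: atlas_compatible.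
Qed.

Lemma smooth_map_differentiable N M (i : N -> M) e e' p :
  smooth_map i -> atlas e -> atlas e' -> chart_dom e p -> chart_dom e' (i p) ->
  differentiable (e' \o i \o chart_inv e) (e p).
Proof.
move=> [_ si] ae ae' ep eip; have [+ _] := si e e' ae ae' 1%N; apply.
by split; [exists p|rewrite chart_mapK].
Qed.

Section PushForward.
Context {N M : smooth_manifold K} (i : N -> M) (si : smooth_map i).
Variables (e : chart K N (mdim N)) (e' : chart K M (mdim M)).
Hypotheses (ae : atlas e) (ae' : atlas e').
Variables (g : K -> N) (t : K).
Hypotheses (cg : {for t, continuous g}) (eg : chart_dom e (g t))
  (eg' : chart_dom e' (i (g t))) (dg : derivable (e \o g) t 1).

Let f := e' \o i \o chart_inv e.

Let near_coord : \forall s \near t, (f \o (e \o g)) s = (e' \o i \o g) s.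
Proof.
near=> s; rewrite /f /= chart_mapK//.
by near: s; exact: near_chart_dom.
Unshelve. all: by end_near. Qed.

Let df : differentiable f ((e \o g) t).
Proof. exact: smooth_map_differentiable. Qed.

Lemma derivable_push_curve : derivable (e' \o i \o g) t 1.
Proof.
apply: near_eq_derivable; first exact: near_coord.
exact: derivable_comp_rV.
Qed.

Lemma derive1_push_curve :
  derive1 (e' \o i \o g) t = derive1 (e \o g) t *m 'J f (e (g t)).
Proof.
rewrite derive1E -(near_eq_derive _ near_coord) -derive1E.
exact: derive1_comp_rV.
Qed.

End PushForward.

Lemma C1_curve_push N M (i : N -> M) (g : K -> N) :
  smooth_map i -> C1_curve g -> C1_curve (i \o g).
Proof.
move=> si [U [oU U01 cg dg]]; exists U; split => //.
  move=> t Ut; apply: continuous_comp; first exact: cg.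
  exact: si.1.
move=> e' t ae' Ut egt'.
pose e := chart_at (g t).
have ae : atlas e := chart_at_atlas _.
have eg : chart_dom e (g t) := chart_at_dom _.
have cgt : {for t, continuous g} by exact: cg.
have [dgt cdgt] := dg e t ae Ut eg.
split; first exact: (@derivable_push_curve _ _ _ si e).
have cig : {for t, continuous (i \o g)}.
  by apply: continuous_comp => //; exact: si.1.
have nU : \forall s \near t, U s by exact: open_nbhs_nbhs.
have neg : \forall s \near t, chart_dom e (g s) by exact: near_chart_dom.
have neg' : \forall s \near t, chart_dom e' (i (g s)).
  exact: (@near_chart_dom _ _ e' (i \o g)).
pose f := e' \o i \o chart_inv e.
(* The chain rule holds at all parameters near [t], and displays the derivative
   as a sum of products of continuous functions. *)
have E : \forall s \near t, \sum_j derive1 (e \o g) s 0 j *: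
      'D_(delta_mx 0 j) f (e (g s)) = derive1 (e' \o i \o g) s.
  near=> s; have Us : U s by near: s.
  have es : chart_dom e (g s) by near: s.
  have es' : chart_dom e' (i (g s)) by near: s.
  have cgs : {for s, continuous g} by exact: cg.
  have [dgs _] := dg e s ae Us es.
  rewrite -mulmx_jacobianE; first exact/esym/derive1_push_curve.
  exact: smooth_map_differentiable.
have Et := nbhs_singleton E.
apply: (@cvg_trans _ _ _ _ (near_eq_cvg E)).
have -> : (e' \o (i \o g))^`()%classic t =
  \sum_j derive1 (e \o g) t 0 j *: 'D_(delta_mx 0 j) f (e (g t)) by rewrite Et.
apply: cvg_big => [|j _]; first exact: add_continuous.
apply: cvgZ.
  exact: (cvg_comp (derive1 (e \o g)) (fun v : 'rV_(mdim N) => v 0 j) cdgt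
    (@coord_continuous _ _ _ 0 j _)).
apply: (@continuous_comp _ _ _ (e \o g) ('D_(delta_mx 0 j) f)).
  apply: continuous_comp => //; exact: chart_map_continuous.
have [_ +] := si.2 e e' ae ae' 1%N; apply.
by split; [exists (g t)|rewrite /= chart_mapK].
Unshelve. all: by end_near. Qed.

End Curves.

(** * Speed, length and geodesic distance *)

Section GeodesicDistance.
Context {K : realType}.
Implicit Types N M : riemannian_manifold K.

Lemma quad_form_pullback m n (J : 'M[K]_(m, n)) G v :
  quad_form (gram_pullback J G) v = quad_form G (v *m J).
Proof. by rewrite /quad_form /gram_pullback trmx_mul !mulmxA. Qed.

Lemma riemannian_submanifold_id M : riemannian_submanifold (@idfun M).
Proof.
split; [exact: smooth_map_id| by [] |].
by move=> e e' p ae ae' ep ep'; exact: gram_compatible.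
Qed.

Section SpeedInvariance.
Context {N M : riemannian_manifold K} (i : N -> M)
  (ri : riemannian_submanifold i).
Variables (g : K -> N) (t : K).
Hypothesis cg : {for t, continuous g}.

(** The metric of [N] is the pull-back of that of [M]. *)
Lemma quad_form_push_curve e e' : atlas e -> atlas e' ->
  chart_dom e (g t) -> chart_dom e' (i (g t)) -> derivable (e \o g) t 1 ->
  quad_form (gram e' (i (g t))) (derive1 (e' \o i \o g) t) =
  quad_form (gram e (g t)) (derive1 (e \o g) t).
Proof.
move=> ae ae' eg eg' dg; have [si _ gi] := ri.
have -> := derive1_push_curve si ae ae' cg eg eg' dg.
by rewrite (gi e e' (g t) ae ae' eg eg') quad_form_pullback.
Qed.

End SpeedInvariance.

(** The speed is defined in a chart that varies with the point of the curve;
    any chart can be used instead. *)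
Lemma speedE M (g : K -> M) t e : {for t, continuous g} ->
  atlas e -> chart_dom e (g t) -> derivable (e \o g) t 1 ->
  speed g t = Num.sqrt (quad_form (gram e (g t)) (derive1 (e \o g) t)).
Proof.
move=> cg ae eg dg; rewrite /speed; congr Num.sqrt.
apply: (quad_form_push_curve (riemannian_submanifold_id M) cg ae _ eg _ dg).
  exact: chart_at_atlas.
exact: chart_at_dom.
Qed.

Lemma speed_push N M (i : N -> M) (g : K -> N) t :
  riemannian_submanifold i -> {for t, continuous g} ->
  derivable (chart_at (g t) \o g) t 1 -> speed (i \o g) t = speed g t.
Proof.
move=> ri cg dg; rewrite /speed; congr Num.sqrt.
apply: (quad_form_push_curve ri cg _ _ _ _ dg);
  by [exact: chart_at_atlas | exact: chart_at_dom].
Qed.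

Lemma curve_length_push N M (i : N -> M) (g : K -> N) :
  riemannian_submanifold i -> C1_curve g ->
  curve_length (i \o g) = curve_length g.
Proof.
move=> ri [U [oU U01 cg dg]]; apply: eq_integral => t /set_mem t01.
congr (_%:E); apply: speed_push => //; first by apply: cg; exact: U01.
apply: (dg _ _ _ _ _).1; [exact: chart_at_atlas | exact: U01 |].
exact: chart_at_dom.
Qed.

Lemma piecewise_C1_length_push N M (i : N -> M) p q l :
  riemannian_submanifold i -> piecewise_C1_length p q l ->
  piecewise_C1_length (i p) (i q) l.
Proof.
move=> ri; elim=> [g Cg|p' q' r l1 l2 _ H1 _ H2]; last exact: C1_concat H1 H2.
have [si _ _] := ri; rewrite -(curve_length_push ri Cg).
exact: (C1_piece (C1_curve_push si Cg)).
Qed.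

(** A curve of the submanifold is a curve of the ambient manifold of the same
    length, so that passing to the ambient manifold only adds competitors. *)
Lemma geodesic_dist_push N M (i : N -> M) p q : riemannian_submanifold i ->
  (geodesic_dist (i p) (i q) <= geodesic_dist p q)%E.
Proof.
move=> ri; apply: ereal_inf_le_tmp => l; exact: piecewise_C1_length_push.
Qed.

Lemma piecewise_C1_length_ge0 M (p q : M) l :
  piecewise_C1_length p q l -> (0 <= l)%E.
Proof.
elim=> [g _|p' q' r l1 l2 _ l10 _ l20]; last exact: adde_ge0.
by apply: integral_ge0 => t _; rewrite lee_fin sqrtr_ge0.
Qed.

Lemma geodesic_dist_ge0 M (p q : M) : (0 <= geodesic_dist p q)%E.
Proof.
by apply: le_ereal_inf_tmp => l; exact: piecewise_C1_length_ge0.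
Qed.

Lemma geodesic_dist_triangle M (p q r : M) :
  (geodesic_dist p r <= geodesic_dist p q + geodesic_dist q r)%E.
Proof.
have [->|pq] := eqVneq (geodesic_dist p q) +oo%E.
  by rewrite addye ?leey// gt_eqF// (lt_le_trans ltNy0)// geodesic_dist_ge0.
have [->|qr] := eqVneq (geodesic_dist q r) +oo%E.
  by rewrite addey ?leey// gt_eqF// (lt_le_trans ltNy0)// geodesic_dist_ge0.
have fpq : geodesic_dist p q \is a fin_num.
  by rewrite ge0_fin_numE ?geodesic_dist_ge0// ltey.
have fqr : geodesic_dist q r \is a fin_num.
  by rewrite ge0_fin_numE ?geodesic_dist_ge0// ltey.
apply/lee_addgt0Pr => e e0.
have e20 : (0 < e / 2)%R by rewrite divr_gt0.
have [l1 H1 /ltW l1e] := lb_ereal_inf_adherent e20 fpq.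
have [l2 H2 /ltW l2e] := lb_ereal_inf_adherent e20 fqr.
apply: (@le_trans _ _ (l1 + l2)%E).
  by apply: ereal_inf_lbound; exact: C1_concat H1 H2.
by rewrite [in leRHS](splitr e) EFinD addeACA leeD.
Qed.

End GeodesicDistance.

(** * Monotonicity of the integral *)

Section IntegralMonotonicity.
Context d (T : measurableType d) (R : realType) (mu : {measure set T -> \bar R}).
Local Open Scope ereal_scope.

(** The integral of [f] is at most that of its positive part, and the integral
    of a nonnegative function is a supremum over the simple functions below it.
    This makes it monotone on arbitrary functions, such as the speed of a
    curve. *)
Lemma le_integral_nonmeasurable (D : set T) (f g : T -> \bar R) :
  (forall x, D x -> 0 <= g x) -> (forall x, D x -> f x <= g x) ->
  \int[mu]_(x in D) f x <= \int[mu]_(x in D) g x.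
Proof.
move=> g0 fg; rewrite integralE.
apply: (@le_trans _ _ (\int[mu]_(x in D) f^\+ x)).
  by rewrite geeDl// oppe_le0 integral_ge0.
rewrite !ge0_integralE//; apply: ereal_sup_le => _ [h /= hf <-].
exists h => //= x; apply: (le_trans (hf x)); rewrite !patchE.
by case: ifPn => // /set_mem Dx; rewrite funeposE ge_max fg ?g0.
Qed.

End IntegralMonotonicity.

(** * Continuous families of definite quadratic forms *)

Section QuadraticForms.
Context {K : realType} {n : nat}.

Lemma closed_ball_rV_compact (a : 'rV[K]_n) r :
  compact (closed_ball_ Num.norm a r).
Proof.
apply: bounded_closed_compact; last exact: closed_closed_ball_.
exists (`|a| + r); split => //; first exact: num_real.
move=> x rx u Bu; apply: ltW; apply: le_lt_trans rx.
rewrite -[u](subKr a); apply: (le_trans (ler_normB _ _)).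
by rewrite lerD2l.
Qed.

Lemma quad_formE (G : 'M[K]_n) v :
  quad_form G v = \sum_j \sum_k v 0 k * G k j * v 0 j.
Proof.
rewrite /quad_form mxE; apply: eq_bigr => j _.
by rewrite mxE mulr_suml [v^T _ _]mxE.
Qed.

Lemma quad_formZ (G : 'M[K]_n) a v :
  quad_form G (a *: v) = a ^+ 2 * quad_form G v.
Proof.
by rewrite /quad_form linearZ /= -!scalemxAl -scalemxAr !mxE mulrA expr2.
Qed.

Lemma quad_form_continuous (G : 'rV[K]_n -> 'M[K]_n) (u v : 'rV[K]_n) :
  {for u, continuous G} ->
  {for (u, v), continuous (fun w : 'rV[K]_n * 'rV[K]_n =>
    quad_form (G w.1) w.2 : K^o)}.
Proof.
move=> cG; suff : (quad_form (G w.1) w.2 : K^o) @[w --> (u, v)] -->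
  (quad_form (G u) v : K^o) by [].
under eq_fun do rewrite quad_formE.
rewrite quad_formE.
have c2 (k : 'I_n) :
    ((w : 'rV[K]_n * 'rV[K]_n).2 0 k : K^o) @[w --> (u, v)] --> (v 0 k : K^o).
  apply: (@cvg_comp ('rV[K]_n * 'rV[K]_n)%type 'rV[K]_n K^o snd
    (fun v : 'rV[K]_n => v 0 k) _ (nbhs v)); first exact: cvg_snd.
  exact: coord_continuous.
apply: cvg_big => [|j _]; first exact: add_continuous.
apply: cvg_big => [|k _]; first exact: add_continuous.
apply: cvgM => //; apply: cvgM => //.
apply: (@cvg_comp ('rV[K]_n * 'rV[K]_n)%type 'M[K]_n K^o (fun w => G w.1)
    (fun A : 'M[K]_n => A k j) _ (nbhs (G u))).
  apply: (@cvg_comp ('rV[K]_n * 'rV[K]_n)%type 'rV[K]_n 'M[K]_n fst G _ (nbhs u)).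
    exact: cvg_fst.
  exact: cG.
exact: coord_continuous.
Qed.

Lemma unit_sphere_compact : compact [set v : 'rV[K]_n | `|v| = 1].
Proof.
apply: bounded_closed_compact.
  by exists 1; split => // x x1 v /= ->; exact: ltW.
exact: (@preimage_closed _ _ _ [set 1 : K^o] (fun x _ => @norm_continuous _ _ x)
  (@closed_eq _ _)).
Qed.

(** By homogeneity the ratio of the quadratic form to the squared norm is
    determined on the unit sphere, and is bounded there by compactness. *)
Lemma quad_form_bounds (G : 'rV[K]_n -> 'M[K]_n) (B : set 'rV[K]_n) :
  compact B -> (forall u, B u -> {for u, continuous G}) ->
  (forall u, B u -> forall v, v != 0 -> 0 < quad_form (G u) v) ->
  exists m C, [/\ 0 < m, 0 < C & forall u v, B u ->
    m * `|v| <= Num.sqrt (quad_form (G u) v) <= C * `|v|].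
Proof.
move=> cB cG pG.
pose P := B `*` [set v : 'rV[K]_n | `|v| = 1].
pose q w : K^o := quad_form (G w.1) w.2.
have cP : compact P by exact: compact_setX cB unit_sphere_compact.
have cq : {within P, continuous q}.
  apply: continuous_in_subspaceT => -[u v] /set_mem[/= Bu _].
  by apply: quad_form_continuous; exact: cG.
have nz (v : 'rV[K]_n) : `|v| = 1 -> v != 0.
  by move=> v1; rewrite -normr_eq0 v1 oner_neq0.
have [a [b [a0 b0 ab]]] : exists a b, [/\ 0 < a, 0 < b &
    forall u v, B u -> `|v| = 1 -> a <= quad_form (G u) v <= b].
  have [P0|/set0P P0] := eqVneq P set0.
    exists 1, 1; split => // u v Bu v1; exfalso.
    by have : P (u, v) by []; rewrite P0.
  have [[u1 v1] /set_mem[/= Bu1 v11] min1] := compact_EVT_min P0 cP cq.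
  have [[u2 v2] /set_mem[/= Bu2 v21] max2] := compact_EVT_max P0 cP cq.
  exists (q (u1, v1)), (q (u2, v2)); split.
  - by apply: pG => //; exact: nz.
  - by apply: pG => //; exact: nz.
  - move=> u v Bu v_1; have Puv : (u, v) \in P by exact/mem_set.
    by rewrite (min1 _ Puv) (max2 _ Puv).
exists (Num.sqrt a), (Num.sqrt b); split; rewrite ?sqrtr_gt0//.
move=> u v Bu; have [->|v0] := eqVneq v 0.
  by rewrite normr0 !mulr0 sqrtr_ge0 /quad_form mul0mx mul0mx mxE sqrtr0 lexx.
have v0' : 0 < `|v| by rewrite normr_gt0.
have w1 : `| `|v|^-1 *: v | = 1.
  by rewrite normrZ normfV normr_id mulVf// gt_eqF.
have /andP[la lb] := ab _ _ Bu w1.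
have -> : v = `|v| *: (`|v|^-1 *: v) by rewrite scalerA divff ?scale1r// gt_eqF.
rewrite quad_formZ sqrtrM ?sqr_ge0// sqrtr_sqr normr_id normrZ w1 normr_id mulr1.
rewrite ![_ * `|v|]mulrC !ler_pM2l//.
by rewrite !ler_sqrt ?la ?lb ?(ltW b0)// (le_trans (ltW a0) la).
Qed.

End QuadraticForms.

(** * Upper bound of the geodesic distance in a coordinate ball *)

Section ChartInverse.
Context {K : realType} {M : topologicalType} {n : nat} (e : chart K M n).

Lemma chart_invK u : chart_cod e u -> e (chart_inv e u) = u.
Proof. by move=> [p ep <-]; rewrite chart_mapK. Qed.

Lemma chart_inv_dom u : chart_cod e u -> chart_dom e (chart_inv e u).
Proof. by move=> [p ep <-]; rewrite chart_mapK. Qed.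

Lemma chart_map_cod p : chart_dom e p -> chart_cod e (e p).
Proof. by move=> ep; exists p. Qed.

End ChartInverse.

Section CoordinateBall.
Context {K : realType} {M : riemannian_manifold K}.
Variables (e : chart K M (mdim M)) (ae : atlas e).
Variables (a : 'rV[K]_(mdim M)) (r C : K).

Let B := closed_ball_ Num.norm a r.

Hypotheses (BU : B `<=` chart_cod e) (C0 : 0 < C).
Hypothesis gramC : forall u v, B u ->
  Num.sqrt (quad_form (gram e (chart_inv e u)) v) <= C * `|v|.

Section Segment.
Variables (u w : 'rV[K]_(mdim M)) (Bu : B u) (Bw : B w).

Let v := w - u.
Let line (t : K) := u + t *: v.
Let g (t : K) : M := chart_inv e (line t).
Let U := line @^-1` chart_cod e.

Let line_ball t : `[0, 1]%classic t -> B (line t).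
Proof.
rewrite /= in_itv /= => /andP[t0 t1]; rewrite /B /closed_ball_ /= /line /v.
have -> : a - (u + t *: (w - u)) = (1 - t) *: (a - u) + t *: (a - w).
  by apply/rowP => j; rewrite !mxE; ring.
have t1' : 0 <= 1 - t by rewrite subr_ge0.
apply: (le_trans (ler_normD _ _)); rewrite !normrZ !ger0_norm//.
have -> : r = (1 - t) * r + t * r by ring.
by rewrite lerD// ler_wpM2l.
Qed.

(* Both sides are the limit of the same difference quotient, whether or not [f]
   is differentiable. *)
Let derive1_line n (f : 'rV[K]_(mdim M) -> 'rV[K]_n) t :
  derive1 (f \o line) t = 'D_v f (line t).
Proof.
rewrite /derive1 /derive; set d := (fun _ : K => _); set d' := (fun _ : K => _).
suff -> : d = d' by [].
by apply/funext => h; rewrite /d /d' /line /= scalerDl addrCA.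
Qed.

Let derivable_line t : derivable line t 1.
Proof.
suff : derivable (cst u + (fun s : K => s *: v)) t 1 by [].
apply: derivableD; first exact: derivable_cst.
by apply/derivable1_diffP; exact: differentiableZl.
Qed.

Let line_continuous : continuous line.
Proof.
by move=> t; apply: differentiable_continuous; exact/derivable1_diffP.
Qed.

Let g_continuous t : U t -> {for t, continuous g}.
Proof.
move=> Ut; apply: (@continuous_comp _ _ _ line (chart_inv e)).
  exact: line_continuous.
exact: chart_inv_continuous.
Qed.

Let g_C1 : C1_curve g.
Proof.
exists U; split.
- apply: open_comp; last exact: chart_cod_open.
  by move=> t _; exact: line_continuous.
- by move=> t t01; apply: BU; exact: line_ball.
- exact: g_continuous.
- move=> e1 t ae1 Ut e1g.
  have [+ s1] := @atlas_compatible _ M e e1 ae ae1 1%N.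
  move=> /(_ (line t) (conj Ut e1g)) df.
  split; first exact: (derivable_comp_rV (@derivable_line t) df).
  have -> : derive1 (e1 \o g) = 'D_v (e1 \o chart_inv e) \o line.
    by apply/funext => s; exact: derive1_line.
  apply: continuous_comp; first exact: line_continuous.
  exact: s1.
Qed.

Let g_speed t : `[0, 1]%classic t -> speed g t <= C * `|v|.
Proof.
move=> t01; have Bt := line_ball t01.
have Ut : U t by exact: BU.
have near_id : \forall z \near line t, (e \o chart_inv e) z = id z.
  have : nbhs (line t) (chart_cod e).
    by apply: open_nbhs_nbhs; split => //; exact: chart_cod_open.
  by apply: filterS => z; exact: chart_invK.
have dg : derivable (e \o g) t 1.
  have [+ _] := @atlas_compatible _ M e e ae ae 1%N.
  move=> /(_ (line t) (conj Ut (chart_inv_dom Ut))) df.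
  exact: (derivable_comp_rV (@derivable_line t) df).
rewrite (speedE (g_continuous Ut) ae (chart_inv_dom Ut) dg).
have -> : derive1 (e \o g) t = v.
  by rewrite (derive1_line (e \o chart_inv e)) (near_eq_derive _ near_id) derive_id.
exact: gramC.
Qed.

Lemma geodesic_dist_segment :
  (geodesic_dist (chart_inv e u) (chart_inv e w) <= (C * `|w - u|)%:E)%E.
Proof.
apply: (@le_trans _ _ (curve_length g)).
  apply: ereal_inf_lbound.
  have -> : chart_inv e u = g 0 by rewrite /g /line scale0r addr0.
  have -> : chart_inv e w = g 1 by rewrite /g /line scale1r subrKC.
  exact: C1_piece.
apply: (@le_trans _ _ (\int[lebesgue_measure]_(t in `[0%R, 1%R])
    cst (C * `|v|)%:E t)%E).
  apply: le_integral_nonmeasurable => t t01; rewrite lee_fin.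
    by apply: mulr_ge0 => //; exact: ltW.
  exact: g_speed.
by rewrite integral_cst//= lebesgue_measure_itv /= lte_fin ltr01 oppr0 adde0 mule1.
Qed.

End Segment.

End CoordinateBall.

(** * A C^1 bump function on coordinates *)

Section Bump.
Context {K : realType}.

(** Squaring makes the positive part C^1 at 0. *)
Definition sqr_pos (s : K) : K := Num.max s 0 ^+ 2.

Lemma is_derive_sqr_pos (s : K) : is_derive s 1 sqr_pos (2 * Num.max s 0).
Proof.
have [s0|s0|->] := ltgtP s 0.
- rewrite mulr0.
  apply: (@near_eq_is_derive _ _ _ (cst 0)).
    have := lt_nbhsl s0; apply: filterS => z z0.
    by rewrite /sqr_pos max_r ?ltW// expr0n.
- apply: (@near_eq_is_derive _ _ _ (fun z : K => z ^+ 2 : K)).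
    have := lt_nbhsr s0; apply: filterS => z z0.
    by rewrite /sqr_pos max_l ?ltW.
  apply: (is_derive_eq (is_deriveX 2 (is_derive_id s 1))).
  by rewrite expr1 [LHS]mulr1.
- rewrite mulr0.
  (* The difference quotient at [0] is the positive part of [h]. *)
  have E : (fun h : K => h^-1 *: ((sqr_pos \o shift 0) (h *: 1) - sqr_pos 0)) =
      (fun h => Num.max h 0).
    apply/funext => h /=; rewrite /sqr_pos addr0 maxxx expr0n subr0.
    rewrite /GRing.scale /= mulr1 expr2.
    have [h0|h0] := leP h 0; first by rewrite mul0r mulr0.
    by rewrite mulrA mulVf ?mul1r// gt_eqF.
  have c : (fun h : K => h^-1 *: ((sqr_pos \o shift 0) (h *: 1) - sqr_pos 0))
      @ 0^' --> (0 : K).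
    rewrite E -[X in _ --> X](maxxx (0 : K)).
    apply: cvg_within_filter.
    by apply: (@continuous_max K K id (cst 0)); [exact: cvg_id | exact: cvg_cst].
  split; last exact/cvg_lim.
  by apply/cvg_ex; exists 0.
Qed.

Context {n : nat}.
Variable a : 'rV[K]_n.

(** The Euclidean distance is used because the supremum norm of row vectors is
    not differentiable. *)
Definition sqr_dist (u : 'rV[K]_n) : K := \sum_i (u 0 i - a 0 i) ^+ 2.

(** Every coordinate is bounded by the Euclidean norm. *)
Lemma sqr_dist_ball r u : 0 <= r -> sqr_dist u <= r ^+ 2 ->
  closed_ball_ Num.norm a r u.
Proof.
move=> r0 ur; rewrite /closed_ball_ /= [leLHS]/Num.Def.normr/= mx_normrE.
apply: bigmax_le => // -[i j] _; rewrite /= ord1 !mxE distrC.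
rewrite -(ler_pXn2r (n := 2))// ?nnegrE// -normrX ger0_norm ?sqr_ge0//.
apply: le_trans ur; rewrite /sqr_dist (bigD1 j)//= lerDl.
by apply: sumr_ge0 => k _; exact: sqr_ge0.
Qed.

Lemma is_derive_sqr_dist (u : K -> 'rV[K]_n) t : derivable u t 1 ->
  is_derive t 1 (sqr_dist \o u)
    (\sum_i 2 * (u t 0 i - a 0 i) * derive1 u t 0 i).
Proof.
move=> du.
have -> : sqr_dist \o u = \sum_i (fun s => (u s 0 i - a 0 i) ^+ 2).
  by apply/funext => s /=; rewrite /sqr_dist fct_sumE.
apply: is_derive_sum => i.
have di : is_derive t 1 (fun s => u s 0 i) (derive1 u t 0 i).
  split; first exact: (derivable_mxP u t 1).1.
  by rewrite derive1E derive_mx// mxE.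
have db : is_derive t 1 (fun s => u s 0 i - a 0 i) (derive1 u t 0 i).
  by apply: is_derive_eq; rewrite subr0.
have dX := is_deriveX 2 db.
by apply: (@is_derive_eq _ _ _ _ _ _ _ _ dX); rewrite expr1.
Qed.

Variable r : K.

Definition coord_bump (u : 'rV[K]_n) : K := sqr_pos (r ^+ 2 - sqr_dist u).

Lemma is_derive_coord_bump (u : K -> 'rV[K]_n) t : derivable u t 1 ->
  is_derive t 1 (coord_bump \o u)
    (2 * Num.max (r ^+ 2 - sqr_dist (u t)) 0 *
     - \sum_i 2 * (u t 0 i - a 0 i) * derive1 u t 0 i).
Proof.
move=> du.
apply: (@is_derive1_comp _ sqr_pos (fun s => r ^+ 2 - sqr_dist (u s))).
  exact: is_derive_sqr_pos.
have dd := is_derive_sqr_dist du.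
have dB := is_deriveB (is_derive_cst (r ^+ 2 : K) t 1) dd.
by apply: (is_derive_eq dB); rewrite sub0r.
Qed.

(** The first factor vanishes outside the ball of radius [r], and inside it
    bounds the displacement from the centre. *)
Lemma derive1_coord_bump_le (u v : 'rV[K]_n) : 0 <= r ->
  `|2 * Num.max (r ^+ 2 - sqr_dist u) 0 *
     - \sum_i 2 * (u 0 i - a 0 i) * v 0 i| <= 4 * n%:R * r ^+ 3 * `|v|.
Proof.
move=> r0.
have R0 : 0 <= 4 * n%:R * r ^+ 3 * `|v| by rewrite !mulr_ge0// exprn_ge0.
have [ur|ur] := leP (r ^+ 2 - sqr_dist u) 0.
  by rewrite mulr0 mul0r normr0.
rewrite normrM normrN.
have d0 : 0 <= sqr_dist u by apply: sumr_ge0 => k _; exact: sqr_ge0.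
have Bu : closed_ball_ Num.norm a r u.
  by apply: sqr_dist_ball => //; apply: ltW; rewrite -subr_gt0.
have h1 : `|2 * (r ^+ 2 - sqr_dist u)| <= 2 * r ^+ 2.
  by rewrite ger0_norm; [rewrite ler_pM2l// lerBlDr lerDl | rewrite mulr_ge0// ltW].
have h2 : `|\sum_i 2 * (u 0 i - a 0 i) * v 0 i| <= 2 * r * `|v| * n%:R.
  apply: (le_trans (ler_norm_sum _ _ _)).
  have -> : 2 * r * `|v| * n%:R = \sum_(i < n) 2 * r * `|v|.
    by rewrite sumr_const card_ord mulr_natr.
  apply: ler_sum => i _; rewrite !normrM (ger0_norm (_ : 0 <= 2))// -!mulrA.
  rewrite ler_pM2l//; apply: ler_pM => //; last exact: norm_coord_le.
  rewrite distrC; apply: le_trans Bu.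
  by have := norm_coord_le (a - u) i; rewrite !mxE.
apply: (le_trans (ler_pM _ _ h1 h2)) => //.
have -> // : 4 * n%:R * r ^+ 3 * `|v| = 2 * r ^+ 2 * (2 * r * `|v| * n%:R).
by ring.
Qed.

End Bump.

(** * The bump function on a manifold *)

Section ChartBump.
Context {K : realType} {M : riemannian_manifold K}.
Variables (e : chart K M (mdim M)) (ae : atlas e).
Variables (a : 'rV[K]_(mdim M)) (r m : K).

Let B := closed_ball_ Num.norm a r.

Hypotheses (r0 : 0 < r) (m0 : 0 < m) (BU : B `<=` chart_cod e).
Hypothesis gramm : forall u v, B u ->
  m * `|v| <= Num.sqrt (quad_form (gram e (chart_inv e u)) v).

(** Extended by zero outside the chart.  This is C^1 along curves since the
    support is compact, hence closed in the Hausdorff space [M]. *)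
Definition chart_bump (q : M) : K :=
  if `[< chart_dom e q >] then coord_bump a r (e q) else 0.

Lemma chart_bumpE q : chart_dom e q -> chart_bump q = coord_bump a r (e q).
Proof. by move=> eq; rewrite /chart_bump asboolT. Qed.

Lemma chart_ball_compact : compact (chart_inv e @` B).
Proof.
apply: continuous_compact.
  by apply: continuous_in_subspaceT => u /set_mem Bu;
    apply: chart_inv_continuous; exact: BU.
exact: closed_ball_rV_compact.
Qed.

Lemma chart_ball_closed : closed (chart_inv e @` B).
Proof.
exact: compact_closed (@manifold_hausdorff _ M) chart_ball_compact.
Qed.

Lemma chart_bump_out q : ~ (chart_inv e @` B) q -> chart_bump q = 0.
Proof.
move=> nBq; rewrite /chart_bump; case: asboolP => // eq.
rewrite /coord_bump /sqr_pos max_r ?expr0n// leNgt; apply/negP => d0.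
apply: nBq; exists (e q); last by rewrite chart_mapK.
by apply: sqr_dist_ball; [exact: ltW | rewrite -subr_ge0 ltW].
Qed.

Lemma chart_bump_center p : chart_dom e p -> e p = a -> chart_bump p = r ^+ 4.
Proof.
move=> ep epa; rewrite chart_bumpE// epa /coord_bump.
have -> : sqr_dist a a = 0.
  by apply: big1 => i _; rewrite subrr expr0n.
by rewrite subr0 /sqr_pos max_l ?sqr_ge0// -exprM.
Qed.

(** Since the chart is injective, the squared Euclidean distance to the centre
    vanishes at the centre only.  This is what makes the geodesic distance
    separate points. *)
Lemma chart_bump_lt p q : chart_dom e p -> e p = a -> q != p ->
  chart_bump q < chart_bump p.
Proof.
move=> ep epa qp; have r40 : 0 < r ^+ 4 by exact: exprn_gt0.
rewrite (chart_bump_center ep epa); have [eq|neq] := pselect (chart_dom e q);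
  last by rewrite /chart_bump asboolF.
rewrite chart_bumpE// /coord_bump /sqr_pos.
have d0 : 0 < sqr_dist a (e q).
  rewrite lt_neqAle sumr_ge0 ?andbT; last by move=> i _; exact: sqr_ge0.
  apply: contra_neq qp => /esym d0.
  rewrite -(chart_mapK eq) -(chart_mapK ep) epa; congr chart_inv.
  apply/rowP => i; apply/eqP; rewrite -subr_eq0 -sqrf_eq0.
  move: d0 => /eqP; rewrite psumr_eq0 => [/allP/(_ i)|j _]; last exact: sqr_ge0.
  by rewrite mem_index_enum => /(_ isT).
have -> : r ^+ 4 = (r ^+ 2) ^+ 2 by rewrite -exprM.
have [h|h] := leP (r ^+ 2 - sqr_dist a (e q)) 0.
  by rewrite expr0n /= !exprn_gt0.
by rewrite ltr_pXn2r ?nnegrE ?sqr_ge0 ?(ltW h)// ltrBlDr ltrDl.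
Qed.

Section AlongCurve.
Variables (g : K -> M) (V : set K) (oV : open V)
  (cg : forall t, V t -> {for t, continuous g})
  (dg : forall t, V t -> chart_dom e (g t) ->
    derivable (e \o g) t 1 /\ {for t, continuous (derive1 (e \o g))}).

Let h := chart_bump \o g.

(* The derivative along the curve, as long as it stays in the chart. *)
Let dh_in (t : K) : K := 2 * Num.max (r ^+ 2 - sqr_dist a (e (g t))) 0 *
  - \sum_i 2 * ((e \o g) t 0 i - a 0 i) * derive1 (e \o g) t 0 i.

Let near_V t : V t -> \forall s \near t, V s.
Proof. by move=> Vt; exact: open_nbhs_nbhs. Qed.

Let is_derive_in t : V t -> chart_dom e (g t) -> is_derive t 1 h (dh_in t).
Proof.
move=> Vt et.
apply: (@near_eq_is_derive _ _ _ (coord_bump a r \o (e \o g))).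
  have := near_chart_dom (cg Vt) et.
  by apply: filterS => s es; rewrite /h /= chart_bumpE.
exact: is_derive_coord_bump (dg Vt et).1.
Qed.

Let near_out t : V t -> ~ (chart_inv e @` B) (g t) -> \forall s \near t, h s = 0.
Proof.
move=> Vt nBt.
have : \forall s \near t, (~` (chart_inv e @` B)) (g s).
  apply: (cg Vt); apply: open_nbhs_nbhs; split => //.
  exact/closed_openC/chart_ball_closed.
by apply: filterS => s; exact: chart_bump_out.
Qed.

Let out_ball q : ~ chart_dom e q -> ~ (chart_inv e @` B) q.
Proof.
by move=> nq [u Bu uq]; apply: nq; rewrite -uq; apply: chart_inv_dom; exact: BU.
Qed.

Let is_derive_out t : V t -> ~ chart_dom e (g t) -> is_derive t 1 h 0.
Proof.
move=> Vt net; apply: (@near_eq_is_derive _ _ _ (cst 0)).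
by apply: filterS (near_out Vt (out_ball net)) => s ->.
Qed.

Lemma derivable_bump_curve t : V t -> derivable h t 1.
Proof.
move=> Vt; have [et|net] := pselect (chart_dom e (g t)).
  by have [] := is_derive_in Vt et.
by have [] := is_derive_out Vt net.
Qed.

Lemma continuous_derive1_bump_curve t : V t -> {for t, continuous (derive1 h)}.
Proof.
move=> Vt; have [et|net] := pselect (chart_dom e (g t)); last first.
  have E : \forall s \near t, 0 = derive1 h s.
    have := nbhs_interior (near_out Vt (out_ball net)); apply: filterS => s hs.
    rewrite derive1E -(@near_eq_derive _ _ _ (cst 0)) ?derive_cst//.
    by apply: filterS hs => z ->.
  suff : derive1 h @ t --> derive1 h t by [].
  rewrite -(nbhs_singleton E).
  by apply: (@cvg_trans _ _ _ _ (near_eq_cvg E)); exact: cvg_cst.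
have E : \forall s \near t, dh_in s = derive1 h s.
  near=> s; have Vs : V s by near: s; exact: near_V.
  have es : chart_dom e (g s) by near: s; exact: near_chart_dom (cg Vt) et.
  by rewrite derive1E; have [_ ->] := is_derive_in Vs es.
have [det cdet] := dg Vt et.
suff : derive1 h @ t --> derive1 h t by [].
rewrite -(nbhs_singleton E).
apply: (@cvg_trans _ _ _ _ (near_eq_cvg E)).
have cu i : {for t, continuous (fun s => (e \o g) s 0 i : K)}.
  apply: (@continuous_comp _ _ _ (e \o g) (fun v : 'rV_(mdim M) => v 0 i)).
    apply: continuous_comp; [exact: cg | exact: chart_map_continuous].
  exact: coord_continuous.
have cdu i : {for t, continuous (fun s => derive1 (e \o g) s 0 i : K)}.
  apply: (@continuous_comp _ _ _ (derive1 (e \o g))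
    (fun v : 'rV_(mdim M) => v 0 i)) => //.
  exact: coord_continuous.
have cub i : (fun s => (e \o g) s 0 i - a 0 i : K) @ t -->
    ((e \o g) t 0 i - a 0 i : K).
  by apply: (cvgB (cu i)); exact: cvg_cst.
apply: cvgM.
  apply: cvgM; first exact: cvg_cst.
  apply: (@continuous_max K K (fun s => r ^+ 2 - sqr_dist a (e (g s))) (cst 0));
    last exact: cvg_cst.
  apply: cvgB; first exact: cvg_cst.
  apply: cvg_big => [|i _]; first exact: add_continuous.
  by under eq_fun do rewrite expr2; rewrite expr2; apply: cvgM; exact: cub.
apply: cvgN; apply: cvg_big => [|i _]; first exact: add_continuous.
apply: cvgM; last exact: cdu.
by apply: cvgM; [exact: cvg_cst | exact: cub].
Unshelve. all: by end_near. Qed.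

(** The summand [1] keeps the constant positive in dimension 0. *)
Definition bump_slope : K := 4 * (mdim M)%:R * r ^+ 3 / m + 1.

Lemma bump_slope_gt0 : 0 < bump_slope.
Proof.
rewrite ltr_wpDl// !mulr_ge0// ?invr_ge0 ?exprn_ge0//; exact: ltW.
Qed.

Lemma derive1_bump_curve_le t : V t -> `|derive1 h t| <= bump_slope * speed g t.
Proof.
move=> Vt; have s0 : 0 <= speed g t by exact: sqrtr_ge0.
have [Bt|nBt] := pselect ((chart_inv e @` B) (g t)); last first.
  have h0 := near_out Vt nBt.
  rewrite derive1E (@near_eq_derive _ _ _ _ (cst 0))// derive_cst.
  by rewrite normr0 mulr_ge0// ltW// bump_slope_gt0.
have et : chart_dom e (g t).
  by have [u Bu <-] := Bt; apply: chart_inv_dom; exact: BU.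
have [u Bu ut] := Bt.
have eu : e (g t) = u by rewrite -ut chart_invK//; exact: BU.
have [det _] := dg Vt et.
rewrite derive1E; have [_ ->] := is_derive_in Vt et.
apply: (le_trans (derive1_coord_bump_le _ _ _ (ltW r0))).
rewrite (speedE (cg Vt) ae et det) -[in gram _ _]ut.
have := gramm (derive1 (e \o g) t) Bu.
set w := derive1 _ _; set S := Num.sqrt _ => mS.
have wS : `|w| <= S / m by rewrite ler_pdivlMr// mulrC.
have S0 : 0 <= S by exact: sqrtr_ge0.
rewrite /bump_slope [leRHS]mulrDl mul1r -[leLHS]addr0 lerD//.
rewrite -[leRHS]mulrA [m^-1 * S]mulrC ler_wpM2l//.
by rewrite mulr_ge0// exprn_ge0// ltW.
Qed.

End AlongCurve.

Lemma chart_bump_curve_length (g : K -> M) : C1_curve g ->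
  ((bump_slope^-1 * (chart_bump (g 0) - chart_bump (g 1)))%:E <=
   curve_length g)%E.
Proof.
move=> [V [oV V01 cg dg']].
have dg t : V t -> chart_dom e (g t) ->
    derivable (e \o g) t 1 /\ {for t, continuous (derive1 (e \o g))}.
  by move=> Vt; exact: dg'.
pose h := chart_bump \o g; pose k := - bump_slope^-1.
have dh t : V t -> is_derive t 1 (k \*: h) (k * derive1 h t).
  move=> Vt; have dht : is_derive t 1 h (derive1 h t).
    by split; [exact: (derivable_bump_curve cg dg) | rewrite derive1E].
  exact: is_deriveZ.
have ch t : V t -> {for t, continuous (k \*: h)}.
  by move=> Vt; apply: differentiable_continuous; apply/derivable1_diffP;
    have [] := dh t Vt.
have -> : bump_slope^-1 * (chart_bump (g 0) - chart_bump (g 1)) =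
    (k \*: h) 1 - (k \*: h) 0.
  by rewrite /k /h /= /GRing.scale /=; ring.
rewrite EFinB.
rewrite -(@continuous_FTC2 _ (fun t => k * derive1 h t) (k \*: h))//.
- apply: le_integral_nonmeasurable => t t01; rewrite lee_fin ?sqrtr_ge0//.
  apply: (le_trans (ler_norm _)); rewrite /k normrM normrN.
  rewrite [X in X * _]ger0_norm ?invr_ge0 ?(ltW bump_slope_gt0)//.
  rewrite ler_pdivrMl ?bump_slope_gt0//.
  by apply: (derive1_bump_curve_le cg dg); exact: V01.
- apply: continuous_in_subspaceT => t /set_mem/V01 Vt.
  apply: cvgM; first exact: cvg_cst.
  exact: (continuous_derive1_bump_curve oV cg dg).
- split.
  + move=> t t01; have [] // := dh t; apply: V01.
    exact: subset_itv_oo_cc.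
  + by apply: cvg_at_right_filter; apply: ch;
      apply: V01; rewrite /= in_itv/= lexx ler01.
  + by apply: cvg_at_left_filter; apply: ch;
      apply: V01; rewrite /= in_itv/= lexx ler01.
- move=> t t01; rewrite derive1E.
  by have [|_ ->] := dh t => //; apply: V01; exact: subset_itv_oo_cc.
Qed.

(** The estimate along one C^1 curve adds up along a concatenation, wherever the
    intermediate points lie. *)
Lemma chart_bump_lipschitz p q :
  ((bump_slope^-1 * (chart_bump p - chart_bump q))%:E <= geodesic_dist p q)%E.
Proof.
apply: le_ereal_inf_tmp => l /=; elim=> [g Cg|p' q' s l1 l2 _ H1 _ H2].
  exact: chart_bump_curve_length.
have -> : bump_slope^-1 * (chart_bump p' - chart_bump s) =
  bump_slope^-1 * (chart_bump p' - chart_bump q') +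
  bump_slope^-1 * (chart_bump q' - chart_bump s) by ring.
by rewrite EFinD leeD.
Qed.

End ChartBump.

(** * Local comparison with coordinates and closest points *)

Section LocalGeometry.
Context {K : realType} {M : riemannian_manifold K}.

(** The closed ball is compact and the metric depends continuously on the point,
    so that it is uniformly equivalent to the norm of the coordinates. *)
Lemma coordinate_ball (p : M) (e := chart_at p) : exists r m C,
  [/\ 0 < r, 0 < m, 0 < C, closed_ball_ Num.norm (e p) r `<=` chart_cod e &
   forall u v, closed_ball_ Num.norm (e p) r u ->
     m * `|v| <= Num.sqrt (quad_form (gram e (chart_inv e u)) v) <= C * `|v|].
Proof.
have ae : atlas e by exact: chart_at_atlas.
have ep : chart_dom e p by exact: chart_at_dom.
have : nbhs (e p) (chart_cod e).
  by apply: open_nbhs_nbhs; split; [exact: chart_cod_open | exact: chart_map_cod].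
move=> /nbhs_closedballP[r]; rewrite closed_ballE// => rU.
have cB : compact (closed_ball_ Num.norm (e p) r%:num).
  exact: closed_ball_rV_compact.
have [||m [C [m0 C0 mC]]] := @quad_form_bounds _ _
    (fun u => gram e (chart_inv e u)) _ cB.
- by move=> u /rU; exact: (gram_smooth ae 0%N).
- by move=> u /rU/chart_inv_dom eu v; exact: gram_pos.
by exists r%:num, m, C; split.
Qed.

Lemma geodesic_dist_refl (p : M) : geodesic_dist p p = 0%E.
Proof.
have [r [m [C [r0 m0 C0 BU mC]]]] := coordinate_ball p.
apply/eqP; rewrite eq_le geodesic_dist_ge0 andbT.
have Bp : closed_ball_ Num.norm (chart_at p p) r (chart_at p p).
  by rewrite /closed_ball_ /= subrr normr0 ltW.
have gC u v Bu := proj2 (andP (mC u v Bu)).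
have := geodesic_dist_segment (chart_at_atlas p) BU C0 gC Bp Bp.
by rewrite subrr normr0 mulr0 chart_mapK//; exact: chart_at_dom.
Qed.

Lemma near_geodesic_dist (p : M) (eps : K) : 0 < eps ->
  \forall q \near p, (geodesic_dist q p < eps%:E)%E.
Proof.
move=> eps0; have [r [m [C [r0 m0 C0 BU mC]]]] := coordinate_ball p.
pose e := chart_at p.
have ep : chart_dom e p by exact: chart_at_dom.
have gC u v Bu := proj2 (andP (mC u v Bu)).
have d0 : 0 < Num.min r (eps / C) by rewrite lt_min r0 divr_gt0.
have /cvgrPdist_lt/(_ _ d0) nep : e @ p --> e p by exact: chart_map_continuous.
have ned : \forall q \near p, chart_dom e q.
  by apply: open_nbhs_nbhs; split => //; exact: chart_dom_open.
apply: filterS2 nep ned => q; rewrite lt_min => /andP[qr qC] eq.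
have Bp : closed_ball_ Num.norm (e p) r (e p).
  by rewrite /closed_ball_ /= subrr normr0 ltW.
have Bq : closed_ball_ Num.norm (e p) r (e q) by exact: ltW.
have := geodesic_dist_segment (chart_at_atlas p) BU C0 gC Bq Bp.
rewrite !chart_mapK// => /le_lt_trans; apply.
by rewrite lte_fin -ltr_pdivlMl// mulrC.
Qed.

Lemma geodesic_dist_gt0 (p q : M) : q != p -> (0 < geodesic_dist p q)%E.
Proof.
move=> qp; have [r [m [C [r0 m0 C0 BU mC]]]] := coordinate_ball p.
have gm u v Bu := proj1 (andP (mC u v Bu)).
apply: lt_le_trans (chart_bump_lipschitz (chart_at_atlas p) r0 m0 BU gm p q).
rewrite lte_fin mulr_gt0 ?invr_gt0 ?bump_slope_gt0// subr_gt0.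
by apply: chart_bump_lt => //; exact: chart_at_dom.
Qed.

(** The bump vanishes outside the coordinate ball, which bounds from below the
    distance from the centre to any point outside.  Inside, the distance is
    Lipschitz in coordinates. *)
Lemma geodesic_ball_subset_compact (p : M) : exists eps : K, exists B : set M,
  [/\ 0 < eps, compact B, forall q, (geodesic_dist p q < eps%:E)%E -> B q,
      forall q, B q -> geodesic_dist p q \is a fin_num &
      {within B, continuous (fun q => fine (geodesic_dist p q))}].
Proof.
have [r [m [C [r0 m0 C0 BU mC]]]] := coordinate_ball p.
pose e := chart_at p.
have ae : atlas e by exact: chart_at_atlas.
have ep : chart_dom e p by exact: chart_at_dom.
have gm u v Bu := proj1 (andP (mC u v Bu)).
have gC u v Bu := proj2 (andP (mC u v Bu)).
pose B := chart_inv e @` closed_ball_ Num.norm (e p) r.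
have Bp : closed_ball_ Num.norm (e p) r (e p).
  by rewrite /closed_ball_ /= subrr normr0 ltW.
have dB q q' : B q -> B q' -> (geodesic_dist q q' <= (C * `|e q' - e q|)%:E)%E.
  move=> [u Bu <-] [w Bw <-].
  rewrite (chart_invK (BU _ Bu)) (chart_invK (BU _ Bw)).
  exact: (geodesic_dist_segment ae BU C0 gC Bu Bw).
have BBp : B p by exists (e p); rewrite ?chart_mapK.
have fB q : B q -> geodesic_dist p q \is a fin_num.
  move=> Bq; rewrite ge0_fin_numE ?geodesic_dist_ge0//.
  by apply: (le_lt_trans (dB _ _ BBp Bq)); rewrite ltry.
exists ((@bump_slope _ M r m)^-1 * r ^+ 4), B; split => //.
- by rewrite mulr_gt0 ?exprn_gt0// invr_gt0 bump_slope_gt0.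
- exact: chart_ball_compact.
- move=> q; apply: contraPP => nBq; apply/negP; rewrite -leNgt.
  have := chart_bump_lipschitz ae r0 m0 BU gm p q.
  by rewrite (chart_bump_center _ ep erefl) (chart_bump_out r0 nBq) subr0.
apply/subspace_continuousP => q Bq; apply/cvgrPdist_lt => eps eps0.
have eq : chart_dom e q by have [u Bu <-] := Bq; apply/chart_inv_dom/BU.
have eC0 : 0 < eps / C by rewrite divr_gt0.
have /cvgrPdist_lt/(_ _ eC0) neq : e @ q --> e q by exact: chart_map_continuous.
rewrite near_withinE; apply: filterS neq => q' qq' Bq'.
have lip : C * `|e q - e q'| < eps by rewrite -ltr_pdivlMl// mulrC.
have h1 := le_trans (geodesic_dist_triangle p q' q) (leeD2l _ (dB _ _ Bq' Bq)).
have h2 := le_trans (geodesic_dist_triangle p q q') (leeD2l _ (dB _ _ Bq Bq')).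
rewrite -(fineK (fB _ Bq)) -(fineK (fB _ Bq')) -!EFinD !lee_fin in h1 h2.
rewrite [`|e q' - e q|]distrC in h2.
rewrite ltr_distl; apply/andP; split.
  by rewrite ltrBlDr; apply: (le_lt_trans h2); rewrite ltrD2l.
by apply: (le_lt_trans h1); rewrite ltrD2l.
Qed.

(** Points outside the compact ball are farther away than [q], so that it
    suffices to minimize over the compact part of [A]. *)
Lemma closest_point_exists (p : M) : exists2 eps : K, 0 < eps &
  forall (A : set M) q, closed A -> A q -> (geodesic_dist p q < eps%:E)%E ->
  exists2 y, A y & forall y', A y' -> (geodesic_dist p y <= geodesic_dist p y')%E.
Proof.
have [eps [B [eps0 cB ballB fB ctB]]] := geodesic_ball_subset_compact p.
exists eps => // A q cA Aq dq; have Bq : B q by exact: ballB.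
have AB0 : B `&` A !=set0 by exists q.
have cdAB : {within B `&` A, continuous (fun q => fine (geodesic_dist p q))}.
  exact: continuous_subspaceW ctB.
have [y /set_mem[By Ay] miny] := compact_EVT_min AB0 (compact_closedI cB cA) cdAB.
have minB y' : B y' -> A y' -> (geodesic_dist p y <= geodesic_dist p y')%E.
  move=> By' Ay'; rewrite -(fineK (fB _ By)) -(fineK (fB _ By')) lee_fin.
  by apply: miny; exact/mem_set.
exists y => // y' Ay'; have [By'|nBy'] := pselect (B y'); first exact: minB.
apply: (le_trans (minB _ Bq Aq)); apply: (le_trans (ltW dq)).
by rewrite leNgt; apply/negP => /ballB.
Qed.

End LocalGeometry.

(** * Comparison of upper limits *)

Section LimsupComparison.
Context {K : realType} {T : choiceType} {X : filteredType T}.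
Local Open Scope ereal_scope.

(** Only the sets on which [g] is bounded matter, since the others contribute
    [+oo] to the infimum defining the upper limit of [g]. *)
Lemma limf_esup_le_of_bounded (f g : X -> \bar K) (F : set_system X) :
  Filter F ->
  (forall (m : K) A, F A -> (forall x, A x -> g x <= m%:E) ->
     \forall x \near F, A x -> f x <= g x) ->
  limf_esup f F <= limf_esup g F.
Proof.
move=> FF fg; apply: le_ereal_inf_tmp => _ [A FA <-].
have [->|sN] := eqVneq (ereal_sup (g @` A)) +oo; first exact: leey.
have [m gm] : exists m : K, forall x, A x -> g x <= m%:E.
  have gs x : A x -> g x <= ereal_sup (g @` A).
    by move=> Ax; apply: ereal_sup_ubound; exists x.
  case: (ereal_sup (g @` A)) sN gs => [s _ gs|//|_ gs]; first by exists s.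
  by exists 0%R => x /gs/le_trans; apply; exact: leNye.
have FB := filterI FA (fg m A FA gm).
apply: (@le_trans _ _ (ereal_sup (f @` [set x | A x /\ (A x -> f x <= g x)]))).
  apply: ereal_inf_lbound.
  by exists [set x | A x /\ (A x -> f x <= g x)]; [exact: FB|].
apply: ge_ereal_sup => _ [x [Ax fgx] <-]; apply: (le_trans (fgx Ax)).
by apply: ereal_sup_ubound; exists x.
Qed.

End LimsupComparison.

(** * The canonical solution map *)

Section CanonicalSolution.
Context {K : realType} {X Y : riemannian_manifold K} {Z : smooth_manifold K}.
Variables (F : X * Y -> Z) (c : Z).

(** The base point is at distance 0 from itself and no other point is. *)
Lemma canonical_solution_base x0 y0 : F (x0, y0) = c ->
  canonical_solution F c y0 x0 = Some y0.
Proof.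
move=> F0; apply: xget_unique.
  exists y0 => //; split => // y' _.
  by rewrite geodesic_dist_refl geodesic_dist_ge0.
move=> _ [y [Fy miny] <-]; congr Some; apply/eqP; apply: contraT => yy0.
have := geodesic_dist_gt0 yy0.
by rewrite ltNge -(geodesic_dist_refl y0) miny.
Qed.

Lemma canonical_solution_closest y0 x y :
  canonical_solution F c y0 x = Some y -> closest_solutions F c y0 x y.
Proof.
by rewrite /canonical_solution; case: xgetP => [_ -> [y' y'c <-] [<-]|].
Qed.

Lemma canonical_solution_some y0 x : closest_solutions F c y0 x !=set0 ->
  exists2 y, canonical_solution F c y0 x = Some y &
    closest_solutions F c y0 x y.
Proof.
move=> [y yc].
have : [set Some y | y in closest_solutions F c y0 x]
    (canonical_solution F c y0 x).
  by apply: xgetPex; exists (Some y), y.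
by move=> [y' y'c y'E]; exists y'.
Qed.

End CanonicalSolution.

(** * Monotonicity of the latent condition number *)

Theorem corollary1p2 (K : realType) (X Y Yhat : riemannian_manifold K)
    (incl : Yhat -> Y) (Z : smooth_manifold K) (chat c : Z)
    (R : X * Yhat -> Z) (S : X * Y -> Z)
    (hYhat : riemannian_submanifold incl)
    (hR : FCRE R chat) (hS : FCRE S c)
    (hRS : forall (x : X) (y : Yhat), R (x, y) = chat -> S (x, incl y) = c)
    (x0 : X) (y0 : Yhat) (h0 : R (x0, y0) = chat) :
  (latent_condition_number S c x0 (incl y0)
     <= latent_condition_number R chat x0 y0)%E.
Proof.
have closed_fibre x : closed [set y | S (x, y) = c].
  have [[cS _] _ _] := hS.
  apply: (@preimage_closed _ _ (fun y => S (x, y)) [set c]).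
    move=> y _; apply: (@continuous_comp _ _ _ (fun y => (x, y)) S).
      by apply: cvg_pair; [exact: cvg_cst | exact: cvg_id].
    exact: cS.
  apply: accessible_closed_set1; apply: hausdorff_accessible.
  exact: manifold_hausdorff.
have [eps eps0 closest] := closest_point_exists (incl y0).
rewrite /latent_condition_number /condition_number.
rewrite (canonical_solution_base h0) (canonical_solution_base (hRS _ _ h0)).
rewrite ge_max !le_max lexx /=; apply/orP; right.
apply: limf_esup_le_of_bounded => m A FA Am.
(* A positive bound is needed to divide by it. *)
pose M := Num.max m 0 + 1.
have M0 : 0 < M by rewrite ltr_wpDl// le_max lexx orbT.
have mM : m <= M by rewrite /M; apply: ler_wpDr => //; rewrite le_max lexx.
have /nbhs_dnbhs := near_geodesic_dist x0 (divr_gt0 eps0 M0).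
apply: filterS => x dx Ax; have {Am} := Am _ Ax.
set D := geodesic_dist x x0 in dx *.
have D0 : (0 <= D)%E by exact: geodesic_dist_ge0.
case E : (canonical_solution R chat y0 x) => [yh|] /=; last first.
  (* Without a minimizer the quotient would be infinite. *)
  move=> le_m; exfalso; move: le_m dx D0; case: D => [d| |]//.
  rewrite inver lee_fin; case: eqP => [-> |/eqP d0 +_ d0'].
    by rewrite mulyy.
  by rewrite gt0_mulye// lte_fin invr_gt0 lt_neqAle eq_sym d0.
move=> le_m; have [Ryh _] := canonical_solution_closest E.
(* The bound on the quotient brings [yh] within reach of the existence of
   closest points for [S]. *)
have dR : (geodesic_dist y0 yh < eps%:E)%E.
  have dR0 := geodesic_dist_ge0 y0 yh.
  move: le_m dx D0; case: D => [d| |]//; rewrite inver !lte_fin lee_fin.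
  case: eqP => [-> + _ _|/eqP d0 + dx d0'].
    move: dR0; rewrite le_eqVlt => /predU1P[<- _|dR0]; first by rewrite lte_fin.
    by rewrite gt0_muley.
  have {d0'}d0 : 0 < d by rewrite lt_neqAle eq_sym d0.
  rewrite lee_pdivrMr// => /le_lt_trans; apply.
  rewrite -EFinM lte_fin; apply: (le_lt_trans (ler_wpM2r (ltW d0) mM)).
  by rewrite mulrC -ltr_pdivlMr.
have le_dist : (geodesic_dist (incl y0) (incl yh) <= geodesic_dist y0 yh)%E.
  exact: geodesic_dist_push.
have Syh : S (x, incl yh) = c by exact: hRS.
have [y Sy miny] := closest _ _ (closed_fibre x) Syh (le_lt_trans le_dist dR).
have [y' -> [_ miny']] := @canonical_solution_some _ _ _ _ S c (incl y0) x
  (ex_intro _ y (conj Sy miny)).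
apply: lee_wpmul2r; first by rewrite inve_ge0.
exact: le_trans (miny' _ Syh) le_dist.
Qed.
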